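(* Let $n\geq 3$, let $\mathcal L\subseteq\mathbb R^n$ be the Lorentz cone and $\mathcal C=\mathbb S^{n-1}\cap\operatorname{int}(\mathcal L)$. Let $\{v^1,\dots,v^n\}$ be an orthonormal system of eigenvectors of $A=A^\top\in\mathbb R^{n\times n}$ corresponding to the eigenvalues $\lambda_1,\dots,\lambda_n$, respectively, and assume that $\lambda_1=:\lambda<\mu:=\lambda_2=\dots=\lambda_n$. Then the function $q_A:\mathcal C\to\mathbb R$, $q_A(x)=\langle Ax,x\rangle$, is spherically quasi-convex if and only if $v^1\in\mathcal L$.
   Context: $\langle\cdot,\cdot\rangle$ and $\|\cdot\|$ are the canonical inner product and norm of $\mathbb R^n$; $\mathbb S^{n-1}=\{x\in\mathbb R^n:\|x\|=1\}$. The Lorentz cone is $\mathcal L=\{x=(x_1,\dots,x_n)^\top\in\mathbb R^n: x_1\ge\sqrt{x_2^2+\dots+x_n^2}\}$, and $\operatorname{int}(\mathcal L)$ is its interior. The intrinsic distance on the sphere is $d(x,y)=\arccos\langle x,y\rangle$; a geodesic is the intersection curve of the sphere with a plane through the origin, and a geodesic segment joining $x$ to $y$ is minimal if its length is $d(x,y)$. A set $\mathcal C\subseteq\mathbb S^{n-1}$ is spherically convex if it contains all minimal geodesic segments joining any two of its points (the set $\mathcal C=\mathbb S^{n-1}\cap\operatorname{int}(\mathcal L)$ is spherically convex). A function $f:\mathcal C\to\mathbb R$ on a spherically convex set is spherically quasi-convex if for every minimal geodesic segment $\gamma:I\to\mathcal C$ ($I\subseteq\mathbb R$ an interval), $f(\gamma(t))\le\max\{f(\gamma(t_1)),f(\gamma(t_2))\}$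 for all $t\in[t_1,t_2]\subseteq I$.
   Formalization: The condition v^1 ∈ L is read up to sign, as ''v^1 ∈ L or −v^1 ∈ L'', since the literal claim fails for A = diag(0,1,1), v^1 = −e_1, where q_A is spherically quasi-convex but v^1 ∉ L. *)

(* Defs.v *)
From HB Require Import structures.
From mathcomp Require Import all_boot all_order all_algebra.
From mathcomp Require Import all_classical all_reals all_analysis.

Set Implicit Arguments.
Unset Strict Implicit.
Unset Printing Implicit Defensive.

Import Order.TTheory GRing.Theory Num.Theory.
Import numFieldNormedType.Exports.

Local Open Scope classical_set_scope.
Local Open Scope ring_scope.

(* The norm and topology that the library puts on 'cV[R]_n.+1 come from the
   sup norm. The Euclidean norm is enorm below; both norms define the same
   topology, so interiors and continuity are the usual ones of R^(n+1).
   The first coordinate x_1 of a vector x is x ord0 0. *)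

Definition inner (R : realType) (n : nat) (x y : 'cV[R]_n.+1) : R :=
  \sum_(i < n.+1) x i 0 * y i 0.

Definition enorm (R : realType) (n : nat) (x : 'cV[R]_n.+1) : R :=
  Num.sqrt (inner x x).

Definition unit_sphere (R : realType) (n : nat) : set 'cV[R]_n.+1 :=
  [set x | enorm x = 1].
Arguments unit_sphere : clear implicits.

Definition lorentz_cone (R : realType) (n : nat) : set 'cV[R]_n.+1 :=
  [set x | Num.sqrt (\sum_(i < n.+1 | i != ord0) x i 0 ^+ 2) <= x ord0 0].
Arguments lorentz_cone : clear implicits.

Definition sphere_dist (R : realType) (n : nat) (x y : 'cV[R]_n.+1) : R :=
  acos (inner x y).

(* Euclidean length of the polygonal line inscribed in g with parameters
   a < s_0 < s_1 < ... < s_k = b (Euclidean analogue of the real-valued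
   variation of the library). *)
Definition polygon_length (R : realType) (n : nat) (g : R -> 'cV[R]_n.+1)
    (a b : R) (s : seq R) : R :=
  \sum_(0 <= k < size s) enorm (g (nth b (a :: s) k.+1) - g (nth b (a :: s) k)).

Definition curve_length (R : realType) (n : nat) (g : R -> 'cV[R]_n.+1)
    (a b : R) : \bar R :=
  ereal_sup [set (polygon_length g a b s)%:E | s in [set s | itv_partition a b s]].

(* A curve on [a, b] running in the intersection of the sphere with a plane
   through the origin. No particular parametrization is imposed. *)
Definition geodesic_segment (R : realType) (n : nat) (g : R -> 'cV[R]_n.+1)
    (a b : R) : Prop :=
  {within `[a, b], continuous g} /\
  exists P : {vspace 'cV[R]_n.+1}, \dim P = 2%N /\
    forall t, t \in `[a, b] -> unit_sphere R n (g t) /\ g t \in P.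

Definition minimal_geodesic_segment (R : realType) (n : nat)
    (g : R -> 'cV[R]_n.+1) (a b : R) : Prop :=
  geodesic_segment g a b /\
  curve_length g a b = (sphere_dist (g a) (g b))%:E.

(* Only the values of f on C matter. *)
Definition spherically_quasiconvex (R : realType) (n : nat)
    (C : set 'cV[R]_n.+1) (f : 'cV[R]_n.+1 -> R) : Prop :=
  forall (g : R -> 'cV[R]_n.+1) (a b : R), a <= b ->
    minimal_geodesic_segment g a b ->
    (forall t, t \in `[a, b] -> C (g t)) ->
    forall t1 t2 t, a <= t1 -> t1 <= t -> t <= t2 -> t2 <= b ->
      f (g t) <= Num.max (f (g t1)) (f (g t2)).

(* If A has the orthonormal eigenvectors v_1, ..., v_n for the eigenvalues
   lambda < mu = ... = mu, then on the sphere quad_fun A x equals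
   mu - (mu - lambda) <v_1, x>^2. It therefore determines v_1 only up to sign,
   and a condition on it that places v_1 in the Lorentz cone has to be read
   up to sign as well. *)
Definition quad_fun (R : realType) (n : nat) (A : 'M[R]_n.+1)
    (x : 'cV[R]_n.+1) : R :=
  inner (A *m x) x.

(* Main.v *)
Require Import Defs.
From HB Require Import structures.
From mathcomp Require Import all_boot all_order all_algebra.
From mathcomp Require Import all_classical all_reals all_analysis.
From mathcomp Require Import ring lra.

Set Implicit Arguments.
Unset Strict Implicit.
Unset Printing Implicit Defensive.

Import Order.TTheory GRing.Theory Num.Theory.
Import numFieldNormedType.Exports.

Local Open Scope classical_set_scope.
Local Open Scope ring_scope.

(** Write w for the eigenvector of the eigenvalue lambda. Expanding in the
    eigenbasis, the quadratic form on the unit sphere is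
    mu - (mu - lambda) <w, x>^2 (quad_fun_rank_one), so quasi-convexity says
    that <w, x>^2, along a minimal geodesic, never drops below the smaller of
    its values at two surrounding points.

    If w or -w lies in the cone, self-duality of the cone makes h = <w, .> of
    constant sign on the region, say nonnegative, and h itself may replace h^2.
    In terms of the angle on a great circle h is a sinusoid, and a sinusoid
    that is nonnegative at two points less than pi apart is at least the
    minimum of its two values in between (sinusoid_quasiconcave). It remains
    to see that a minimal geodesic visits its points in the order of their
    angles. All points of the region have a positive first coordinate, so the
    curve stays in an open half circle and lifts to a continuous angle function
    with values in ]-pi/2, pi/2[ (geodesic_angle_lift). The length of a piece of
    the curve is at least the change of angle along it (length_approaches_arc);
    as the total length equals the total change of angle, the angle cannot turn
    back (minimal_geodesic_between).

    If neither w nor -w lies in the cone, the axis of the cone projects onto the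
    hyperplane orthogonal to w at a point interior to the cone
    (orthogonal_point_in_cone). Let z be that point after normalization. On the
    short great-circle arc t |-> cos t z + sin t w around z the form is
    mu - (mu - lambda) sin^2 t, which has a strict maximum at the middle of
    the arc, so quasi-convexity fails. *)

(** * The Euclidean inner product *)

Lemma innerC (R : realType) (n : nat) (x y : 'cV[R]_n.+1) :
  inner x y = inner y x.
Proof. by apply: eq_bigr => i _; rewrite mulrC. Qed.

Lemma innerDl (R : realType) (n : nat) (x y z : 'cV[R]_n.+1) :
  inner (x + y) z = inner x z + inner y z.
Proof. by rewrite -big_split; apply: eq_bigr => i _; rewrite mxE mulrDl. Qed.

Lemma innerZl (R : realType) (n : nat) (k : R) (x y : 'cV[R]_n.+1) :
  inner (k *: x) y = k * inner x y.
Proof. by rewrite mulr_sumr; apply: eq_bigr => i _; rewrite mxE mulrA. Qed.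

Lemma innerDr (R : realType) (n : nat) (x y z : 'cV[R]_n.+1) :
  inner x (y + z) = inner x y + inner x z.
Proof. by rewrite innerC innerDl !(innerC x). Qed.

Lemma innerZr (R : realType) (n : nat) (k : R) (x y : 'cV[R]_n.+1) :
  inner x (k *: y) = k * inner x y.
Proof. by rewrite innerC innerZl innerC. Qed.

Lemma innerNl (R : realType) (n : nat) (x y : 'cV[R]_n.+1) :
  inner (- x) y = - inner x y.
Proof. by rewrite -scaleN1r innerZl mulN1r. Qed.

Lemma innerNr (R : realType) (n : nat) (x y : 'cV[R]_n.+1) :
  inner x (- y) = - inner x y.
Proof. by rewrite innerC innerNl innerC. Qed.

Lemma inner0l (R : realType) (n : nat) (x : 'cV[R]_n.+1) : inner 0 x = 0.
Proof. by rewrite -(scale0r 0) innerZl mul0r. Qed.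

Lemma innerE_mulmx (R : realType) (n : nat) (x y : 'cV[R]_n.+1) :
  inner x y = (x^T *m y) 0 0.
Proof. by rewrite mxE; apply: eq_bigr => i _; rewrite mxE. Qed.

Lemma inner_self_ge0 (R : realType) (n : nat) (x : 'cV[R]_n.+1) :
  0 <= inner x x.
Proof. by apply: sumr_ge0 => i _; rewrite -expr2 sqr_ge0. Qed.

Lemma inner_self_eq0 (R : realType) (n : nat) (x : 'cV[R]_n.+1) :
  inner x x = 0 -> x = 0.
Proof.
move=> /eqP; rewrite psumr_eq0 => [/allP h|i _]; last by rewrite -expr2 sqr_ge0.
apply/matrixP => i j; rewrite ord1 mxE.
by have := h i (mem_index_enum i); rewrite -expr2 sqrf_eq0 => /eqP.
Qed.

Lemma innerE_head_tail (R : realType) (n : nat) (x y : 'cV[R]_n.+1) :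
  inner x y = x ord0 0 * y ord0 0 + \sum_(i < n.+1 | i != ord0) x i 0 * y i 0.
Proof. by rewrite /inner (bigD1 ord0). Qed.

Lemma inner_self_gt0 (R : realType) (n : nat) (x : 'cV[R]_n.+1) :
  x != 0 -> 0 < inner x x.
Proof.
move=> x0; rewrite lt_neqAle inner_self_ge0 andbT eq_sym.
by apply: contra_neq x0 => /inner_self_eq0.
Qed.

Lemma unit_sphereE (R : realType) (n : nat) (x : 'cV[R]_n.+1) :
  unit_sphere R n x <-> inner x x = 1.
Proof.
rewrite /unit_sphere /enorm /=; split => [h|->]; last exact: sqrtr1.
by rewrite -(sqr_sqrtr (inner_self_ge0 x)) h expr1n.
Qed.

Lemma inner_normalize (R : realType) (n : nat) (x : 'cV[R]_n.+1) :
  x != 0 -> inner ((enorm x)^-1 *: x) ((enorm x)^-1 *: x) = 1.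
Proof.
move=> /inner_self_gt0 x0; rewrite innerZl innerZr mulrA -expr2 exprVn.
by rewrite sqr_sqrtr ?ltW// mulVf// gt_eqF.
Qed.

Lemma inner_subr_self (R : realType) (n : nat) (x y : 'cV[R]_n.+1) :
  inner (x - y) (x - y) = inner x x - 2 * inner x y + inner y y.
Proof.
by rewrite !(innerDl, innerDr, innerNl, innerNr) (innerC y x); ring.
Qed.

(** * Great circles and chords *)

Definition orthonormal_pair (R : realType) (n : nat) (e f : 'cV[R]_n.+1) : Prop :=
  [/\ inner e e = 1, inner f f = 1 & inner e f = 0].

Definition great_circle (R : realType) (n : nat) (e f : 'cV[R]_n.+1) (x : R) :
    'cV[R]_n.+1 :=
  cos x *: e + sin x *: f.

Lemma inner_great_circle (R : realType) (n : nat) (e f : 'cV[R]_n.+1) (x y : R) :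
  orthonormal_pair e f ->
  inner (great_circle e f x) (great_circle e f y) = cos (x - y).
Proof.
move=> [ee ff ef].
rewrite /great_circle !(innerDl, innerDr, innerZl, innerZr) (innerC f e) ee ff ef.
by rewrite cosB; ring.
Qed.

Lemma cos_half_angle (R : realType) (x : R) : cos x = 1 - 2 * sin (x / 2) ^+ 2.
Proof.
have -> : cos x = cos (x / 2 + x / 2) by congr cos; field.
by rewrite cosD; have := cos2Dsin2 (x / 2); lra.
Qed.

Lemma enorm_chord (R : realType) (n : nat) (e f : 'cV[R]_n.+1) (x y : R) :
  orthonormal_pair e f ->
  enorm (great_circle e f x - great_circle e f y) = 2 * `|sin ((x - y) / 2)|.
Proof.
move=> ef; rewrite /enorm inner_subr_self !(inner_great_circle _ _ ef) !subrr cos0.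
rewrite (cos_half_angle (x - y)).
have -> : 1 - 2 * (1 - 2 * sin ((x - y) / 2) ^+ 2) + 1 = (2 * sin ((x - y) / 2)) ^+ 2.
  by ring.
by rewrite sqrtr_sqr normrM ger0_norm.
Qed.

Lemma sin_mvt (R : realType) (x : R) : 0 <= x ->
  exists2 c : R, 0 <= c <= x & sin x = x * cos c.
Proof.
move=> x0.
have [c] := @MVT_segment R sin cos 0 x x0 (fun y _ => is_derive_sin y)
  (continuous_subspaceT (@continuous_sin R)).
rewrite in_itv/= sin0 !subr0 => cx ->; exists c => //; exact: mulrC.
Qed.

Lemma norm_sin_le (R : realType) (x : R) : `|sin x| <= `|x|.
Proof.
wlog x0 : x / 0 <= x => [H|].
  have [/H//|/ltW x0] := leP 0 x.
  by rewrite -normrN -sinN -(normrN x) H// oppr_ge0.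
have [c _ ->] := @sin_mvt R x x0.
by rewrite normrM ler_piMr// ler_norml cos_geN1 cos_le1.
Qed.

(** The mean value theorem gives sin x = x cos c with 0 <= c <= x, and
    cos c = 1 - 2 sin^2 (c/2) >= 1 - x^2/2. *)
Lemma sin_ge_cubic (R : realType) (x : R) : 0 <= x -> x - x ^+ 3 / 2 <= sin x.
Proof.
move=> x0; have [c /andP[c0 cx] ->] := @sin_mvt R x x0.
have : sin (c / 2) ^+ 2 <= (x / 2) ^+ 2.
  have := norm_sin_le (c / 2); rewrite (@ger0_norm _ (c / 2)) ?ler_norml; last lra.
  by move=> /andP[]; nra.
by rewrite (cos_half_angle c) => h; nra.
Qed.

(** A chord falls short of its arc only by a cube of the arc, so cutting the
    arc D into N equal pieces leaves a total defect of order D^3 / N^2. *)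
Lemma chords_approach_arc (R : realType) (D eps : R) : 0 < eps ->
  exists N : nat, `|D| - eps <= N.+1%:R * (2 * `|sin (D / N.+1%:R / 2)|).
Proof.
move=> e0; pose N := Num.trunc (`|D| ^+ 3 / eps).
exists N.
(* The total defect is at most |D|^3 / (8 M^2) with M = N + 1 > |D|^3 / eps. *)
have hN : `|D| ^+ 3 / eps < N.+1%:R by exact: truncnS_gt.
have N1 : 1 <= N.+1%:R :> R by rewrite ler1n.
set M : R := N.+1%:R in hN N1 *.
have M0 : M != 0 by lra.
pose y := `|D| / M / 2.
have y0 : 0 <= y by rewrite !divr_ge0.
have -> : `|sin (D / M / 2)| = `|sin y|.
  rewrite /y; case: (ger0P D) => // D0.
  by rewrite -normrN -sinN -!mulNr.
have Dy : `|D| = M * (2 * y) by rewrite /y; field.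
have h1 := le_trans (@sin_ge_cubic R y y0) (ler_norm _).
have h2 : `|D| ^+ 3 < eps * M by rewrite mulrC -ltr_pdivrMr.
have h3 : M * y ^+ 3 <= eps.
  have : M ^+ 2 * (M * y ^+ 3) <= eps * M by move: h2; rewrite Dy; nra.
  have : 0 <= M * y ^+ 3 by rewrite mulr_ge0 ?exprn_ge0//; lra.
  nra.
have := ler_wpM2l (_ : 0 <= 2 * M) h1; rewrite Dy => /(_ ltac:(lra)).
nra.
Qed.
(** * Polygons inscribed in a curve *)

Lemma polygon_length_nil (R : realType) (n : nat) (g : R -> 'cV[R]_n.+1) (a b : R) :
  polygon_length g a b [::] = 0.
Proof. by rewrite /polygon_length /= big_geq. Qed.

Lemma polygon_length_cons (R : realType) (n : nat) (g : R -> 'cV[R]_n.+1)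
    (a b x : R) (s : seq R) :
  polygon_length g a b (x :: s) = enorm (g x - g a) + polygon_length g x b s.
Proof. by rewrite /polygon_length /= big_nat_recl. Qed.

Lemma polygon_length_cat (R : realType) (n : nat) (g : R -> 'cV[R]_n.+1)
    (a c b : R) (s r : seq R) :
  itv_partition a c s ->
  polygon_length g a b (s ++ r) = polygon_length g a c s + polygon_length g c b r.
Proof.
elim: s a => [|x s IH] a.
  by move=> /itv_partition_nil ->; rewrite polygon_length_nil add0r.
move=> /itv_partition_cons /IH {}IH.
by rewrite cat_cons !polygon_length_cons IH addrA.
Qed.

(** A lower bound for the length that adds up along concatenated pieces, with
    no arithmetic in the extended reals. *)
Definition length_approaches (R : realType) (n : nat) (g : R -> 'cV[R]_n.+1)
    (a b L : R) : Prop :=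
  forall eps, 0 < eps ->
    exists2 s, itv_partition a b s & L - eps <= polygon_length g a b s.

Lemma length_approaches_cat (R : realType) (n : nat) (g : R -> 'cV[R]_n.+1)
    (a c b L1 L2 : R) :
  length_approaches g a c L1 -> length_approaches g c b L2 ->
  length_approaches g a b (L1 + L2).
Proof.
move=> h1 h2 eps e0.
have e20 : 0 < eps / 2 by lra.
have [s hs ls] := h1 _ e20; have [r hr lr] := h2 _ e20.
exists (s ++ r); first exact: itv_partition_cat hs hr.
by rewrite (polygon_length_cat _ _ _ hs); lra.
Qed.

Lemma curve_length_ge (R : realType) (n : nat) (g : R -> 'cV[R]_n.+1) (a b L : R) :
  length_approaches g a b L -> (L%:E <= curve_length g a b)%E.
Proof.
move=> h; apply/lee_addgt0Pr => eps /h[s hs ls].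
apply: (@le_trans _ _ ((polygon_length g a b s)%:E + eps%:E)%E).
  by rewrite -EFinD lee_fin -lerBlDr.
by rewrite leeD2r//; apply: ereal_sup_ubound; exists s.
Qed.

(** By the intermediate value theorem the curve can be cut at points whose
    angles form an arithmetic progression, so all chords but a possible last
    one have the same length; what the curve does between these points is
    irrelevant, as it can only add length. *)
Lemma equal_chords (R : realType) (n : nat) (e f : 'cV[R]_n.+1)
    (g : R -> 'cV[R]_n.+1) (theta : R -> R) (N : nat) (delta s t : R) :
  orthonormal_pair e f -> delta != 0 -> s <= t ->
  {within `[s, t], continuous theta} ->
  (forall x, x \in `[s, t] -> g x = great_circle e f (theta x)) ->
  theta t - theta s = N%:R * delta ->
  exists2 p, itv_partition s t p &
    N%:R * (2 * `|sin (delta / 2)|) <= polygon_length g s t p.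
Proof.
move=> ef d0; elim: N s => [|N IH] s st ct gE hN.
  have [<-|nst] := eqVneq s t.
    by exists [::]; rewrite ?polygon_length_nil ?mul0r.
  exists [:: t]; first by apply: itv_partition1; rewrite lt_neqAle nst.
  by rewrite polygon_length_cons polygon_length_nil addr0 mul0r sqrtr_ge0.
(* The next point of the progression; theta t lies N deltas further. *)
have [c] : exists2 c, c \in `[s, t] & theta c = theta s + delta.
  apply: IVT => //; have -> : theta t = theta s + N.+1%:R * delta by lra.
  have N0 : 0 <= N%:R :> R by [].
  rewrite -natr1 mulrDl mul1r.
  case: (ltgtP delta 0) d0 => // d0 _.
    rewrite min_r ?max_l; nra.
  rewrite min_l ?max_r; nra.
rewrite in_itv/= => /andP[sc ct'] thc.
have {}sc : s < c.
  rewrite lt_neqAle sc andbT; apply: contra_neq d0 => sc'.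
  by move: thc; rewrite sc'; lra.
have [|x|//|p hp lp] := IH c ct'.
- by apply: continuous_subspaceW ct => x /=; rewrite !in_itv/= => /andP[? ->];
    rewrite andbT; lra.
- by rewrite in_itv/= => /andP[cx xt]; apply: gE; rewrite in_itv/= xt andbT; lra.
- by rewrite thc; move: hN; rewrite -natr1; lra.
exists (c :: p).
  by case: hp => hp1 hp2; split => //=; rewrite sc.
have sg : g s = great_circle e f (theta s) by apply: gE; rewrite in_itv/= lexx.
have cg : g c = great_circle e f (theta c).
  by apply: gE; rewrite in_itv/= (ltW sc).
rewrite polygon_length_cons sg cg (enorm_chord _ _ ef) thc.
have -> : theta s + delta - theta s = delta by ring.
by rewrite -natr1 mulrDl mul1r addrC lerD2l.
Qed.

(** No curve on a great circle is shorter than the change of its angle: the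
    equal chords have a total length arbitrarily close to it. *)
Lemma length_approaches_arc (R : realType) (n : nat) (e f : 'cV[R]_n.+1)
    (g : R -> 'cV[R]_n.+1) (theta : R -> R) (s t : R) :
  orthonormal_pair e f -> s <= t ->
  {within `[s, t], continuous theta} ->
  (forall x, x \in `[s, t] -> g x = great_circle e f (theta x)) ->
  length_approaches g s t `|theta t - theta s|.
Proof.
move=> ef st ct gE eps e0.
have [N hN] := chords_approach_arc (theta t - theta s) e0.
have [D0|D0] := eqVneq (theta t - theta s) 0.
  (* With N = 0 the increment is arbitrary, and 1 is a nonzero choice. *)
  have [p hp lp] := @equal_chords R n e f g theta 0 1 s t ef (oner_neq0 R) st ct gE
    (etrans D0 (esym (mul0r 1))).
  by exists p => //; rewrite mul0r in lp; rewrite D0 normr0; lra.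
have [||p hp lp] := @equal_chords R n e f g theta N.+1
  ((theta t - theta s) / N.+1%:R) s t ef _ st ct gE.
- by rewrite mulf_neq0// invr_eq0.
- by field.
by exists p => //; exact: le_trans hN lp.
Qed.

Lemma polygon_length_great_circle_le (R : realType) (n : nat) (e f : 'cV[R]_n.+1)
    (a b : R) (s : seq R) :
  orthonormal_pair e f -> itv_partition a b s ->
  polygon_length (great_circle e f) a b s <= b - a.
Proof.
move=> ef; elim: s a => [|x s IH] a.
  by move=> /itv_partition_nil ->; rewrite polygon_length_nil subrr.
move=> hs; have /IH {}IH := itv_partition_cons hs.
rewrite polygon_length_cons (enorm_chord _ _ ef).
have ax : a < x by case: hs => /= /andP[].
have := norm_sin_le ((x - a) / 2); rewrite (@ger0_norm _ ((x - a) / 2)); lra.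
Qed.

(** * Planes through the origin *)

Lemma orthonormal_pair_free (R : realType) (n : nat) (e f : 'cV[R]_n.+1) :
  orthonormal_pair e f -> free [:: e; f].
Proof.
move=> [ee ff ef]; rewrite free_cons seq1_free span_seq1; apply/andP; split.
  apply/vlineP => -[k ek]; move: ef ee; rewrite ek !innerZl ff mulr1 => ->.
  by rewrite mul0r => /eqP; rewrite eq_sym oner_eq0.
by apply: contra_eq_neq ff => ->; rewrite inner0l eq_sym oner_eq0.
Qed.

(** An orthonormal pair is free, hence a basis of any plane that contains it. *)
Lemma plane_decomposition (R : realType) (n : nat) (P : {vspace 'cV[R]_n.+1})
    (e f x : 'cV[R]_n.+1) :
  \dim P = 2 -> e \in P -> f \in P -> orthonormal_pair e f -> x \in P ->
  x = inner x e *: e + inner x f *: f.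
Proof.
move=> dP eP fP ef xP.
have efP : basis_of P [:: e; f].
  by rewrite basisEfree (orthonormal_pair_free ef) dP andbT; apply/span_subvP => y;
    rewrite !inE => /orP[]/eqP->.
move: xP; rewrite -(span_basis efP) span_cons span_seq1.
move=> /memv_addP[_ /vlineP[k ->] [_ /vlineP[l ->] ->]].
case: ef => ee ff ef.
by rewrite !innerDl !innerZl (innerC f e) ee ff ef !mulr1 !mulr0 addr0 add0r.
Qed.

Lemma great_circle_minimal (R : realType) (n : nat) (e f : 'cV[R]_n.+1) (a b : R) :
  orthonormal_pair e f -> a <= b -> b - a <= pi ->
  minimal_geodesic_segment (great_circle e f) a b.
Proof.
move=> ef ab bapi; split; first split.
- apply: continuous_subspaceT => x.
  by apply: cvgD; apply: cvgZr_tmp; [exact: continuous_cos|exact: continuous_sin].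
- exists <<[:: e; f]>>%VS; split; first exact/eqP/orthonormal_pair_free.
  move=> t _; split; first by apply/unit_sphereE; rewrite inner_great_circle// subrr cos0.
  by rewrite memvD// memvZ// memv_span// !inE eqxx ?orbT.
rewrite /sphere_dist (inner_great_circle _ _ ef) -cosN opprB cosK; last first.
  by rewrite in_itv/= bapi andbT; lra.
apply/eqP; rewrite eq_le; apply/andP; split.
  apply: ge_ereal_sup => _ [s hs <-]; rewrite lee_fin.
  exact: polygon_length_great_circle_le.
apply: curve_length_ge.
have := @length_approaches_arc R n e f (great_circle e f) id a b ef ab
  (continuous_subspaceT (fun x => cvg_id)) (fun _ _ => erefl).
by rewrite ger0_norm// subr_ge0.
Qed.

(** Every plane contains a direction f orthogonal to the first axis. Measuring
    angles from the direction e orthogonal to f makes the first coordinate of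
    the point at angle x equal to cos x times the first coordinate of e, so
    that the half-space of positive first coordinate is that of angles in
    ]-pi/2, pi/2[. *)
Lemma adapted_orthonormal_pair (R : realType) (n : nat)
    (P : {vspace 'cV[R]_n.+1}) (p : 'cV[R]_n.+1) :
  \dim P = 2 -> p \in P -> 0 < p ord0 0 ->
  exists e f, [/\ e \in P, f \in P, orthonormal_pair e f, 0 < e ord0 0 &
    f ord0 0 = 0].
Proof.
move=> dP pP p0.
have [q qP qp] : exists2 q, q \in P & q \notin <[p]>%VS.
  apply/subvPn/negP => /dimvS; rewrite dP dim_vline; by case: (p == 0).
pose f0 := q - (q ord0 0 / p ord0 0) *: p.
have f00 : f0 != 0.
  by apply: contraNneq qp => /eqP; rewrite subr_eq0 => /eqP ->; rewrite memvZ ?memv_line.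
pose f := (enorm f0)^-1 *: f0.
have ff : inner f f = 1 by exact: inner_normalize.
have fh : f ord0 0 = 0.
  by rewrite !mxE divfK ?subrr ?mulr0// gt_eqF.
have fP : f \in P by rewrite memvZ// memvB// memvZ.
clearbody f.
pose e0 := p - inner p f *: f.
have e0h : e0 ord0 0 = p ord0 0.
  by rewrite !mxE fh mulr0 subr0.
have e00 : e0 != 0.
  by apply: contraTneq p0 => e00; rewrite -e0h e00 mxE ltxx.
exists ((enorm e0)^-1 *: e0), f; split => //.
- by rewrite memvZ// memvB// memvZ.
- split => //; first exact: inner_normalize.
  by rewrite innerZl innerDl innerNl innerZl ff mulr1 subrr mulr0.
- rewrite mxE e0h mulr_gt0// invr_gt0 sqrtr_gt0; exact: inner_self_gt0.
Qed.

(** A positive first coordinate forces <x, e> > 0, so that <x, e> is the cosine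
    of the angle whose sine is <x, f> and asin recovers the angle. *)
Lemma great_circle_asin (R : realType) (n : nat) (P : {vspace 'cV[R]_n.+1})
    (e f x : 'cV[R]_n.+1) :
  \dim P = 2 -> e \in P -> f \in P -> orthonormal_pair e f ->
  0 < e ord0 0 -> f ord0 0 = 0 ->
  x \in P -> unit_sphere R n x -> 0 < x ord0 0 ->
  -1 < inner x f < 1 /\ x = great_circle e f (asin (inner x f)).
Proof.
move=> dP eP fP ef e0 f0 xP /unit_sphereE xx x0.
have xE := plane_decomposition dP eP fP ef xP.
have xe0 : 0 < inner x e.
  move: x0; rewrite {1}xE 2!mxE [X in _ + X]mxE f0 mulr0 addr0.
  by rewrite pmulr_lgt0.
have xexf : inner x e ^+ 2 + inner x f ^+ 2 = 1.
  have := xx; rewrite {1}xE innerDl !innerZl (innerC e) (innerC f).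
  by rewrite !expr2.
have xf : -1 < inner x f < 1.
  by apply/andP; split; nra.
split => //; rewrite {1}xE /great_circle asinK ?in_itv/=; last first.
  by case/andP: xf => /ltW-> /ltW->.
congr (_ *: _ + _); rewrite cos_asin; last by case/andP: xf => /ltW-> /ltW->.
by rewrite -xexf addrK sqrtr_sqr gtr0_norm.
Qed.
(** * Minimal geodesics in an open half-space *)

Lemma inner_continuous (R : realType) (n : nat) (y : 'cV[R]_n.+1) :
  continuous (fun x : 'cV[R]_n.+1 => inner x y).
Proof.
apply: continuous_big => [|i _ x]; first exact: add_continuous.
exact: cvgMr_tmp (@coord_continuous _ _ _ i 0 x).
Qed.

Definition angle_lift (R : realType) (n : nat) (g : R -> 'cV[R]_n.+1)
    (a b : R) (e f : 'cV[R]_n.+1) (theta : R -> R) : Prop :=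
  [/\ orthonormal_pair e f, {within `[a, b], continuous theta},
    forall t, t \in `[a, b] -> - (pi / 2) < theta t < pi / 2 &
    forall t, t \in `[a, b] -> g t = great_circle e f (theta t)].

Lemma geodesic_angle_lift (R : realType) (n : nat) (g : R -> 'cV[R]_n.+1) (a b : R) :
  a <= b -> geodesic_segment g a b ->
  (forall t, t \in `[a, b] -> 0 < g t ord0 0) ->
  exists e f theta, angle_lift g a b e f theta.
Proof.
move=> ab [cg [P [dP gP]]] g0.
have aab : a \in `[a, b] by rewrite in_itv/= lexx.
have [e [f [eP fP ef e0 f0]]] := adapted_orthonormal_pair dP (gP a aab).2 (g0 a aab).
have gE t : t \in `[a, b] -> -1 < inner (g t) f < 1 /\
    g t = great_circle e f (asin (inner (g t) f)).
  by move=> tab; have [gS gt] := gP t tab; exact: great_circle_asin dP eP fP ef e0 f0 gt gS (g0 t tab).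
exists e, f, (fun t => asin (inner (g t) f)); split => //.
- apply/subspace_continuousP => t tab.
  have [tf _] := gE t tab.
  apply: (cvg_comp (fun t => inner (g t) f) asin); last exact: continuous_asin.
  apply: (cvg_comp g (fun x => inner x f)); last exact: inner_continuous.
  by move/subspace_continuousP : cg; apply.
- move=> t /gE[/andP[h1 h2] _].
  by rewrite asin_gtNpi2 ?asin_ltpi2 ?h1 ?h2 ?(ltW h1) ?(ltW h2).
- by move=> t /gE[].
Qed.

Lemma acos_cos_norm (R : realType) (x : R) : `|x| <= pi -> acos (cos x) = `|x|.
Proof.
move=> xpi; have -> : cos x = cos `|x|.
  by have [//|_] := ger0P x; rewrite cosN.
by rewrite cosK// in_itv/= normr_ge0.
Qed.

Lemma ler_normD_same_sign (R : realType) (x y : R) :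
  `|x| + `|y| <= `|x + y| -> (0 <= x /\ 0 <= y) \/ (x <= 0 /\ y <= 0).
Proof.
case: (ger0P x) => hx; case: (ger0P y) => hy; case: (ger0P (x + y)) => hxy h;
  ((by left; split; lra) || (by right; split; lra) || lra).
Qed.

(** Minimality leaves no room for detours: the changes of angle over [a, t1],
    [t1, t], [t, t2], [t2, b] add up to at most the length, that is, to the
    change over [a, b]. By the triangle inequality the changes over [t1, t]
    and [t, t2] then have the same sign. *)
Lemma minimal_geodesic_between (R : realType) (n : nat) (g : R -> 'cV[R]_n.+1)
    (a b : R) (e f : 'cV[R]_n.+1) (theta : R -> R) (t1 t t2 : R) :
  angle_lift g a b e f theta ->
  curve_length g a b = (sphere_dist (g a) (g b))%:E ->
  a <= t1 -> t1 <= t -> t <= t2 -> t2 <= b ->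
  theta t1 <= theta t <= theta t2 \/ theta t2 <= theta t <= theta t1.
Proof.
move=> [ef ct thpi gE] lg at1 t1t tt2 t2b.
have ab : a <= b by lra.
have approach x y : a <= x -> x <= y -> y <= b ->
    length_approaches g x y `|theta y - theta x|.
  move=> ax xy yb.
  have sub z : z \in `[x, y] -> z \in `[a, b].
    by rewrite !in_itv/= => /andP[xz zy]; apply/andP; split; lra.
  apply: (length_approaches_arc ef xy) => [|z /sub]; last exact: gE.
  by apply: continuous_subspaceW ct => z; exact: sub.
have aab : a \in `[a, b] by rewrite in_itv/= lexx.
have bab : b \in `[a, b] by rewrite in_itv/= lexx andbT.
have := curve_length_ge (length_approaches_cat (approach a t1 _ _ _)
  (length_approaches_cat (approach t1 t _ _ _)
    (length_approaches_cat (approach t t2 _ _ _) (approach t2 b _ _ _)))).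
rewrite lg lee_fin /sphere_dist gE// gE// inner_great_circle// acos_cos_norm; last first.
  have /andP[? ?] := thpi _ aab; have /andP[? ?] := thpi _ bab.
  by rewrite ler_norml; apply/andP; split; lra.
rewrite (distrC (theta a)) => /(_ ltac:(lra) ltac:(lra) ltac:(lra) ltac:(lra) ltac:(lra) ltac:(lra)
  ltac:(lra) ltac:(lra) ltac:(lra) ltac:(lra) ltac:(lra) ltac:(lra)) le_len.
have := ler_normD (theta t1 - theta a) (theta t2 - theta t1).
have := ler_normD (theta t1 - theta a + (theta t2 - theta t1)) (theta b - theta t2).
have -> : theta t1 - theta a + (theta t2 - theta t1) + (theta b - theta t2) =
  theta b - theta a by ring.
move=> tri1 tri2.
have [] := @ler_normD_same_sign R (theta t - theta t1) (theta t2 - theta t).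
- have -> : theta t - theta t1 + (theta t2 - theta t) = theta t2 - theta t1 by ring.
  lra.
- by move=> [? ?]; left; apply/andP; split; lra.
- by move=> [? ?]; right; apply/andP; split; lra.
Qed.
(** * The Lorentz cone *)

(** Adding the square of the first coordinate to both sides of the defining
    inequality turns the cone condition into one on the full inner product,
    which is the form that behaves well under projection and scaling. *)
Lemma lorentz_coneE (R : realType) (n : nat) (x : 'cV[R]_n.+1) :
  lorentz_cone R n x <-> 0 <= x ord0 0 /\ inner x x <= 2 * x ord0 0 ^+ 2.
Proof.
rewrite /lorentz_cone /= innerE_head_tail -expr2.
under [X in _ <-> _ /\ _ + X <= _]eq_bigr do rewrite -expr2.
set T := \sum_(i < n.+1 | i != ord0) _.
have T0 : 0 <= T by apply: sumr_ge0 => i _; exact: sqr_ge0.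
have sT := sqr_sqrtr T0; have sT0 := sqrtr_ge0 T.
by split => [h|[h1 h2]]; [split|]; nra.
Qed.

Lemma lorentz_cone_head_gt0 (R : realType) (n : nat) (x : 'cV[R]_n.+1) :
  lorentz_cone R n x -> x != 0 -> 0 < x ord0 0.
Proof. by move=> /lorentz_coneE[x0 hx] /inner_self_gt0 xx; nra. Qed.

(** With a and b the first coordinates of x and y, the tail of b x + a y has a
    nonnegative square. By the cone conditions its square is at most
    2 a b <x, y>; this avoids the Cauchy-Schwarz inequality for the tails. *)
Lemma lorentz_cone_self_dual (R : realType) (n : nat) (x y : 'cV[R]_n.+1) :
  lorentz_cone R n x -> lorentz_cone R n y -> 0 <= inner x y.
Proof.
move=> Lx Ly.
have [->|x0] := eqVneq x 0; first by rewrite inner0l.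
have [->|y0] := eqVneq y 0; first by rewrite innerC inner0l.
have := lorentz_cone_head_gt0 Ly y0; have := lorentz_cone_head_gt0 Lx x0.
move: Lx Ly => /lorentz_coneE[_ hx] /lorentz_coneE[_ hy].
set a := x ord0 0 in hx *; set b := y ord0 0 in hy * => a0 b0.
have : 0 <= \sum_(i < n.+1 | i != ord0) (b *: x + a *: y) i 0 * (b *: x + a *: y) i 0.
  by apply: sumr_ge0 => i _; rewrite -expr2 sqr_ge0.
have := innerE_head_tail (b *: x + a *: y) (b *: x + a *: y).
rewrite !(innerDl, innerDr, innerZl, innerZr) (innerC y x) => e1 e2.
have {e1 e2} : 4 * (a * b) ^+ 2 <=
    b ^+ 2 * inner x x + 2 * (a * b) * inner x y + a ^+ 2 * inner y y.
  by move: e1 e2; rewrite !mxE -/a -/b; lra.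
have := ler_wpM2l (sqr_ge0 b) hx; have := ler_wpM2l (sqr_ge0 a) hy.
have := mulr_gt0 a0 b0 => ab0 h1 h2 h3.
have : 0 <= (a * b) * inner x y by lra.
by rewrite pmulr_rge0.
Qed.

Lemma interior_lorentz_cone (R : realType) (n : nat) (x : 'cV[R]_n.+1) :
  0 < x ord0 0 -> inner x x < 2 * x ord0 0 ^+ 2 -> interior (lorentz_cone R n) x.
Proof.
move=> x0 hx.
have head : (fun y : 'cV[R]_n.+1 => y ord0 0) @ x --> x ord0 0.
  exact: coord_continuous.
have self : (fun y : 'cV[R]_n.+1 => inner y y) @ x --> inner x x.
  move: x {x0 hx head}; apply: continuous_big => [|i _ x]; first exact: add_continuous.
  exact: cvgM (@coord_continuous _ _ _ i 0 x) (@coord_continuous _ _ _ i 0 x).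
have gap : (fun y : 'cV[R]_n.+1 => 2 * (y ord0 0 * y ord0 0) - inner y y) @ x -->
    2 * (x ord0 0 * x ord0 0) - inner x x.
  by apply: (cvgB _ self); apply: cvgMl_tmp; exact: (cvgM head head).
have gap0 : 0 < 2 * (x ord0 0 * x ord0 0) - inner x x by rewrite subr_gt0 -expr2.
near=> y; apply/lorentz_coneE; split.
  by apply: ltW; near: y; exact: cvgr_gt head _ x0.
by rewrite -subr_ge0 expr2; apply: ltW; near: y; exact: cvgr_gt gap _ gap0.
Unshelve. all: by end_near. Qed.

(** * Quadratic forms with a simple smallest eigenvalue *)

(** The matrix whose columns are the v i has a left inverse, its transpose,
    which is then also a right inverse. *)
Lemma parseval (R : realType) (n : nat) (v : 'I_n.+1 -> 'cV[R]_n.+1)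
    (x y : 'cV[R]_n.+1) :
  (forall i j, inner (v i) (v j) = (i == j)%:R) ->
  inner x y = \sum_i inner (v i) x * inner (v i) y.
Proof.
move=> ov; pose V : 'M[R]_n.+1 := \matrix_(i, j) v j i 0.
have VV : V^T *m V = 1%:M.
  apply/matrixP => i j; rewrite !mxE -ov; apply: eq_bigr => k _.
  by rewrite !mxE.
have VM (a : 'cV[R]_n.+1) i : inner (v i) a = (V^T *m a) i 0.
  by rewrite mxE; apply: eq_bigr => k _; rewrite !mxE.
transitivity (inner (V^T *m x) (V^T *m y)); last first.
  by apply: eq_bigr => i _; rewrite !VM.
by rewrite !innerE_mulmx trmx_mul trmxK mulmxA -(mulmxA x^T) (mulmx1C VV) mulmx1.
Qed.

Lemma inner_symmetric_mul (R : realType) (n : nat) (A : 'M[R]_n.+1)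
    (x y : 'cV[R]_n.+1) :
  A = A^T -> inner x (A *m y) = inner (A *m x) y.
Proof.
by move=> hA; rewrite !innerE_mulmx trmx_mul -hA mulmxA.
Qed.

Lemma quad_fun_rank_one (R : realType) (n : nat) (A : 'M[R]_n.+1)
    (v : 'I_n.+1 -> 'cV[R]_n.+1) (lam : 'I_n.+1 -> R) (mu : R) (x : 'cV[R]_n.+1) :
  A = A^T -> (forall i j, inner (v i) (v j) = (i == j)%:R) ->
  (forall i, A *m v i = lam i *: v i) -> (forall i, i != ord0 -> lam i = mu) ->
  quad_fun A x = mu * inner x x - (mu - lam ord0) * inner (v ord0) x ^+ 2.
Proof.
move=> hA ov ev hmu; rewrite /quad_fun (parseval (A *m x) x ov) (parseval x x ov).
under eq_bigr do rewrite (inner_symmetric_mul _ _ hA) ev innerZl.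
rewrite (bigD1 ord0)//= [in RHS](bigD1 ord0)//=.
rewrite (eq_bigr (fun i => mu * (inner (v i) x * inner (v i) x))); last first.
  by move=> i i0; rewrite hmu// mulrA.
by rewrite -mulr_sumr; ring.
Qed.

(** * Spherical quasi-convexity *)

(** The value in the middle is a combination of the outer values h(x) and h(z)
    with the nonnegative weights sin (z - y) / sin (z - x) and
    sin (y - x) / sin (z - x), whose sum is at least 1 by subadditivity of sine.
    Nonnegativity of h(x) and h(z) is what makes a sum above 1 harmless. *)
Lemma sinusoid_quasiconcave (R : realType) (p q x y z : R) :
  x <= y -> y <= z -> z - x < pi ->
  0 <= p * cos x + q * sin x -> 0 <= p * cos z + q * sin z ->
  Num.min (p * cos x + q * sin x) (p * cos z + q * sin z) <= p * cos y + q * sin y.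
Proof.
move=> xy yz zx; set hx := p * cos x + _; set hy := p * cos y + _; set hz := p * cos z + _.
move=> hx0 hz0.
have [xz|xz] := eqVneq x z.
  have yx : y = x by lra.
  by rewrite ge_min /hx /hy yx lexx.
have s0 : 0 < sin (z - x) by rewrite sin_gt0_pi// zx andbT subr_gt0 lt_neqAle xz; lra.
have a0 : 0 <= sin (z - y) by rewrite sin_ge0_pi//; apply/andP; split; lra.
have b0 : 0 <= sin (y - x) by rewrite sin_ge0_pi//; apply/andP; split; lra.
have interp : hy * sin (z - x) = hx * sin (z - y) + hz * sin (y - x).
  by rewrite /hx /hy /hz !sinB; ring.
have sub : sin (z - x) <= sin (z - y) + sin (y - x).
  have -> : z - x = (z - y) + (y - x) by ring.
  by rewrite sinD; have := cos_le1 (z - y); have := cos_le1 (y - x); nra.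
set m := Num.min hx hz.
have mx : m <= hx by rewrite ge_min lexx.
have mz : m <= hz by rewrite ge_min lexx orbT.
have m0 : 0 <= m by rewrite le_min hx0.
rewrite -(ler_pM2r s0) interp; nra.
Qed.
Lemma unit_cone_head_gt0 (R : realType) (n : nat) (x : 'cV[R]_n.+1) :
  unit_sphere R n x -> interior (lorentz_cone R n) x -> 0 < x ord0 0.
Proof.
move=> /unit_sphereE xx /interior_subset Lx; apply: lorentz_cone_head_gt0 => //.
by apply: contra_eq_neq xx => ->; rewrite inner0l eq_sym oner_eq0.
Qed.

Lemma inner_quasiconcave_on_geodesic (R : realType) (n : nat)
    (w : 'cV[R]_n.+1) (g : R -> 'cV[R]_n.+1) (a b t1 t t2 : R) :
  minimal_geodesic_segment g a b ->
  (forall s, s \in `[a, b] -> 0 < g s ord0 0) ->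
  (forall s, s \in `[a, b] -> 0 <= inner w (g s)) ->
  a <= t1 -> t1 <= t -> t <= t2 -> t2 <= b ->
  Num.min (inner w (g t1)) (inner w (g t2)) <= inner w (g t).
Proof.
move=> [geo len] g0 w0 at1 t1t tt2 t2b.
have ab : a <= b by lra.
have [e [f [theta lift]]] := geodesic_angle_lift ab geo g0.
have btw := minimal_geodesic_between lift len at1 t1t tt2 t2b.
case: lift => ef _ thpi gE.
have t1ab : t1 \in `[a, b] by rewrite in_itv/=; apply/andP; split; lra.
have tab : t \in `[a, b] by rewrite in_itv/=; apply/andP; split; lra.
have t2ab : t2 \in `[a, b] by rewrite in_itv/=; apply/andP; split; lra.
have wE s : s \in `[a, b] ->
    inner w (g s) = inner w e * cos (theta s) + inner w f * sin (theta s).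
  by move=> /gE ->; rewrite innerDr !innerZr; ring.
have := w0 _ t1ab; have := w0 _ t2ab.
have /andP[? ?] := thpi _ t1ab; have /andP[? ?] := thpi _ t2ab.
rewrite !wE// => w2 w1; case: btw => /andP[h1 h2].
  by apply: sinusoid_quasiconcave => //; lra.
by rewrite minC; apply: sinusoid_quasiconcave => //; lra.
Qed.

(** By self-duality <w, .> is nonnegative on the cone, where squaring is
    monotone: quasi-concavity of <w, .> passes to its square. *)
Lemma rank_one_quasiconvex (R : realType) (n : nat) (f : 'cV[R]_n.+1 -> R)
    (w : 'cV[R]_n.+1) (mu k : R) :
  0 <= k -> lorentz_cone R n w ->
  (forall x, unit_sphere R n x -> f x = mu - k * inner w x ^+ 2) ->
  spherically_quasiconvex (unit_sphere R n `&` interior (lorentz_cone R n)) f.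
Proof.
move=> k0 Lw fE g a b ab geo gC t1 t2 t at1 t1t tt2 t2b.
have t1ab : t1 \in `[a, b] by rewrite in_itv/=; apply/andP; split; lra.
have tab : t \in `[a, b] by rewrite in_itv/=; apply/andP; split; lra.
have t2ab : t2 \in `[a, b] by rewrite in_itv/=; apply/andP; split; lra.
have w0 s : s \in `[a, b] -> 0 <= inner w (g s).
  by move=> /gC[_ /interior_subset]; exact: lorentz_cone_self_dual.
have := inner_quasiconcave_on_geodesic geo _ w0 at1 t1t tt2 t2b.
rewrite !fE; [|exact: (gC _ _).1..].
have h1 := w0 _ t1ab; have h2 := w0 _ t2ab.
rewrite ge_min le_max => /(_ _)/orP[s sab|h|h].
- by have [gS gL] := gC s sab; exact: unit_cone_head_gt0.
- by apply/orP; left; rewrite lerD2l lerN2 ler_wpM2l// lerXn2r// nnegrE// w0.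
- by apply/orP; right; rewrite lerD2l lerN2 ler_wpM2l// lerXn2r// nnegrE// w0.
Qed.

(** The point is the normalized projection z of the first axis u onto the
    hyperplane orthogonal to w. With a the first coordinate of w, z has first
    coordinate and squared norm both equal to 1 - a^2, and w, -w outside the
    cone means a^2 < 1/2: then z satisfies 1 - a^2 < 2 (1 - a^2)^2. *)
Lemma orthogonal_point_in_cone (R : realType) (n : nat) (w : 'cV[R]_n.+1) :
  inner w w = 1 -> ~ lorentz_cone R n w -> ~ lorentz_cone R n (- w) ->
  exists z, [/\ inner z z = 1, inner z w = 0 & interior (lorentz_cone R n) z].
Proof.
move=> ww nw nNw; set a := w ord0 0.
have a2 : 2 * a ^+ 2 < 1.
  rewrite ltNge; apply/negP => h; have [a0|/ltW a0] := leP 0 a.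
    by apply: nw; apply/lorentz_coneE; rewrite ww.
  by apply: nNw; apply/lorentz_coneE; rewrite innerNl innerNr opprK ww mxE sqrrN oppr_ge0.
pose u : 'cV[R]_n.+1 := delta_mx ord0 0.
have uE x : inner u x = x ord0 0.
  rewrite innerE_head_tail mxE !eqxx mul1r big1 ?addr0// => i i0.
  by rewrite mxE (negPf i0) mul0r.
pose z := u - a *: w.
have zw : inner z w = 0 by rewrite innerDl innerNl innerZl uE ww -/a; ring.
have zh : z ord0 0 = 1 - a ^+ 2 by rewrite !mxE !eqxx -/a expr2.
have zz : inner z z = 1 - a ^+ 2.
  by rewrite {2}/z innerDr innerNr innerZr zw mulr0 subr0 innerC uE.
clearbody z.
have z0 : z != 0 by apply: contra_eq_neq zz => ->; rewrite inner0l; lra.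
have nz := inner_normalize z0; have ez0 : 0 < (enorm z)^-1.
  by rewrite invr_gt0 sqrtr_gt0; exact: inner_self_gt0.
exists ((enorm z)^-1 *: z); split => //; first by rewrite innerZl zw mulr0.
apply: interior_lorentz_cone; rewrite mxE zh; first by rewrite mulr_gt0//; lra.
move: nz; rewrite innerZl innerZr zz exprMn.
set r := (enorm z)^-1 ^+ 2; rewrite mulrA -expr2 -/r => rE.
have r0 : 0 < r by rewrite exprn_gt0.
nra.
Qed.

(** Moving from z towards w and -w along the great circle through them, the
    function is mu - k sin^2 t, with a strict maximum at the interior time 0. *)
Lemma rank_one_not_quasiconvex (R : realType) (n : nat) (f : 'cV[R]_n.+1 -> R)
    (w : 'cV[R]_n.+1) (mu k : R) :
  0 < k -> inner w w = 1 ->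
  (forall x, unit_sphere R n x -> f x = mu - k * inner w x ^+ 2) ->
  spherically_quasiconvex (unit_sphere R n `&` interior (lorentz_cone R n)) f ->
  lorentz_cone R n w \/ lorentz_cone R n (- w).
Proof.
move=> k0 ww fE qc; apply: contrapT => /not_orP[nw nNw].
have [z [zz zw Lz]] := orthogonal_point_in_cone ww nw nNw.
have ef : orthonormal_pair z w by split.
set g := great_circle z w.
have gS t : unit_sphere R n (g t).
  by apply/unit_sphereE; rewrite inner_great_circle// subrr cos0.
have gh t : f (g t) = mu - k * sin t ^+ 2.
  rewrite fE// /g innerDr !innerZr (innerC w z) zw ww; ring.
have g0 : g 0 = z by rewrite /g /great_circle cos0 sin0 scale1r scale0r addr0.
have /nbhs_ballP[r r0 rL] : \forall t \near (0 : R), interior (lorentz_cone R n) (g t).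
  have cg : {for 0, continuous g}.
    by apply: cvgD; apply: cvgZr_tmp; [exact: continuous_cos|exact: continuous_sin].
  by apply: cg; apply: nbhs_interior; rewrite g0; exact: Lz.
pose d := Num.min (r / 2) 1.
have d0 : 0 < d by rewrite lt_min ltr01 divr_gt0.
have dr : d < r by rewrite gt_min; apply/orP; left; rewrite ltr_pdivrMr//; move: r0 => /=; lra.
have d1 : d <= 1 by rewrite ge_min lexx orbT.
have pi2 := pi_ge2 R.
have sd : 0 < sin d by apply: sin_gt0_pi; apply/andP; split; lra.
have gC t : t \in `[- d, d] -> (unit_sphere R n `&` interior (lorentz_cone R n)) (g t).
  rewrite in_itv/= => td; split => //; apply: rL.
  by rewrite /ball/= sub0r normrN (le_lt_trans _ dr)// ler_norml.
have dd : - d <= d by lra.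
have geo : minimal_geodesic_segment g (- d) d.
  by apply: great_circle_minimal => //; lra.
have := qc g (- d) d dd geo gC (- d) d 0 (lexx _) _ _ (lexx _).
rewrite !gh sin0 sinN sqrrN maxxx => /(_ ltac:(lra) ltac:(lra)).
by have := mulr_gt0 k0 (exprn_gt0 2 sd); lra.
Qed.

Theorem theorem5 (R : realType) (n : nat) (hn : (3 <= n.+1)%N)
  (A : 'M[R]_n.+1) (hA : A = A^T)
  (v : 'I_n.+1 -> 'cV[R]_n.+1) (lam : 'I_n.+1 -> R)
  (horth : forall i j, inner (v i) (v j) = (i == j)%:R)
  (heig : forall i, A *m v i = lam i *: v i)
  (lambda mu : R)
  (hlambda : lam ord0 = lambda)
  (hmu : forall i, i != ord0 -> lam i = mu)
  (hlt : lambda < mu) :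
  spherically_quasiconvex (unit_sphere R n `&` interior (lorentz_cone R n))
    (quad_fun A)
  <-> (lorentz_cone R n (v ord0) \/ lorentz_cone R n (- v ord0)).
Proof.
have gap : 0 < mu - lambda by rewrite subr_gt0.
have qE x : unit_sphere R n x ->
    quad_fun A x = mu - (mu - lambda) * inner (v ord0) x ^+ 2.
  move=> /unit_sphereE xx.
  by rewrite (quad_fun_rank_one x hA horth heig hmu) xx mulr1 hlambda.
split.
  by apply: rank_one_not_quasiconvex gap _ qE; rewrite horth eqxx.
move=> [Lv|Lv]; apply: (rank_one_quasiconvex (ltW gap) Lv) => x /qE -> //.
by rewrite innerNl sqrrN.
Qed.
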